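(* For each $r\ge1$ let $\tilde\alpha$ be the highest root and, for $1\leq i\leq j\leq r$, let $-\alpha_{i,j}$ be the corresponding negative root of the Lie algebra of type $A_r$. Then, as formal power series, \[ \sum_{1\leq i\leq j\leq r} \vert \mathcal{A}_r(\tilde\alpha, -\alpha_{i,j})\vert x^r s^it^j = \frac{1}{t(1-x-x^2)}\left((1-x)\,t\,\mathcal{H}(xt,s)+\mathcal{P}(xt,s)-\frac{xst}{1-xst-(xst)^2}\right), \] where the sum is over all integer triples $(i,j,r)$ with $1\le i\le j\le r$, \[ \mathcal{H}(x,s)=\frac{xs(x^4s+2x^3s-x^2s+xs+x^2+2x+1)}{(1-x-x^2-3x^3-x^4)(1-xs-(xs)^2)} \] and \[ \mathcal{P}(x,s)=\frac{xs(x^4s+3x^3s+x+1)}{(1-x-x^2-3x^3-x^4)(1-xs-(xs)^2)}. \]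
   Context: In type $A_r$ (Lie algebra $\mathfrak{sl}_{r+1}(\mathbb{C})$): the simple roots are $\alpha_k=e_k-e_{k+1}\in\mathbb{R}^{r+1}$ for $1\le k\le r$; the positive roots are $\alpha_{i,j}=\alpha_i+\alpha_{i+1}+\cdots+\alpha_j$ for $1\le i\le j\le r$; the highest root is $\tilde\alpha=\alpha_1+\cdots+\alpha_r$; $\rho$ is half the sum of the positive roots; the Weyl group is $W\cong\mathfrak{S}_{r+1}$ permuting $e_1,\dots,e_{r+1}$. $\wp(\xi)$ is the number of ways of expressing $\xi$ as a linear combination of positive roots with nonnegative integer coefficients, and $\mathcal{A}_r(\lambda,\mu)=\{\sigma\in W:\wp(\sigma(\lambda+\rho)-\mu-\rho)>0\}$. *)

(* Defs.v *)
From HB Require Import structures.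
From mathcomp Require Import all_boot all_order all_fingroup all_algebra.
From mathcomp Require Import finmap.
From mathcomp Require Import boolp classical_sets functions cardinality reals.

Set Implicit Arguments.
Unset Strict Implicit.
Unset Printing Implicit Defensive.

Import Order.TTheory GRing.Theory Num.Theory.

Local Open Scope ring_scope.

(* Weights live in the ambient space R^(r+1); vectors are row vectors.  Roots
   and coordinates are numbered from 1; [basis_vec k] is 0 for k outside
   1 <= k <= r+1. *)

(* Index set of the positive roots: the pair (a, b) of ordinals, a <= b,
   stands for the root alpha_{a+1,b+1}. *)
Notation pos_index r := {p : 'I_r * 'I_r | (p.1 <= p.2)%N}.

Section RootSystemA.
Variables (R : realType) (r : nat).

Definition basis_vec (k : nat) : 'rV[R]_r.+1 := \row_(m < r.+1) (m.+1 == k)%:R.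

Definition simple_root (k : nat) : 'rV[R]_r.+1 := basis_vec k - basis_vec k.+1.

Definition pos_root (i j : nat) : 'rV[R]_r.+1 :=
  \sum_(i <= k < j.+1) simple_root k.

Definition highest_root : 'rV[R]_r.+1 := \sum_(1 <= k < r.+1) simple_root k.

Definition root_of (p : pos_index r) : 'rV[R]_r.+1 :=
  pos_root (val p).1.+1 (val p).2.+1.

Definition rho : 'rV[R]_r.+1 := 2%:R^-1 *: \sum_(p : pos_index r) root_of p.

(* Row-vector convention: s sends e_k to e_(s k), see [weyl_act_basis]. *)
Definition weyl_act (s : 'S_r.+1) (v : 'rV[R]_r.+1) : 'rV[R]_r.+1 :=
  v *m perm_mx s.

Definition root_expressions (xi : 'rV[R]_r.+1) : set {ffun pos_index r -> nat} :=
  [set c | \sum_(p : pos_index r) root_of p *+ c p = xi]%classic.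

(* [fset_set] is meaningful on finite sets only; finiteness is
   [finite_root_expressions]. *)
Definition kostant (xi : 'rV[R]_r.+1) : nat :=
  #|` fset_set (root_expressions xi)|%fset.

Definition weyl_alternation (lambda mu : 'rV[R]_r.+1) : {set 'S_r.+1} :=
  [set s | (0 < kostant (weyl_act s (lambda + rho) - mu - rho)%R)%N].

Lemma weyl_act_basis (s : 'S_r.+1) (k : 'I_r.+1) :
  weyl_act s (basis_vec k.+1) = basis_vec (s k).+1.
Proof.
have E (l : 'I_r.+1) : basis_vec l.+1 = delta_mx 0 l.
  by apply/rowP => m; rewrite !mxE eqSS.
rewrite /weyl_act !E -rowE; apply/rowP => m.
by rewrite !mxE eqxx eq_sym.
Qed.

Let height (v : 'rV[R]_r.+1) : R := \sum_(m < r.+1) (r - m)%:R * v 0 m.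

Let heightD u v : height (u + v) = height u + height v.
Proof.
by rewrite /height -big_split; apply: eq_bigr => m _; rewrite mxE mulrDr.
Qed.

Let height0 : height 0 = 0.
Proof. by rewrite /height big1 // => m _; rewrite mxE mulr0. Qed.

Let heightMn v n : height (v *+ n) = height v *+ n.
Proof. by elim: n => [|n IH]; rewrite ?mulr0n ?height0 // !mulrSr heightD IH. Qed.

Let height_sum (I : Type) (s : seq I) (F : I -> 'rV[R]_r.+1) :
  height (\sum_(i <- s) F i) = \sum_(i <- s) height (F i).
Proof. exact: (big_morph height heightD height0). Qed.

Let height_basis k : (k <= r)%N -> height (basis_vec k.+1) = (r - k)%:R.
Proof.
move=> ler_k; rewrite /height (bigD1 (Ordinal (ler_k : (k < r.+1)%N))) //=.
rewrite !mxE eqxx mulr1 big1 ?addr0 // => m.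
rewrite mxE eqSS => /negP ne; case: eqP => [e|_]; last by rewrite mulr0.
by case: ne; apply/eqP/val_inj.
Qed.

Let height_root p : height (root_of p) = ((val p).2.+1 - (val p).1)%:R.
Proof.
case: p => -[a b] /= le_ab; rewrite /root_of /pos_root /= height_sum.
rewrite (eq_big_nat _ _ (F2 := fun=> 1)); last first.
  move=> k /andP[lt_ak lt_kb]; case: k lt_ak lt_kb => // k _ lt_kb.
  have lt_kr : (k < r)%N by apply: leq_ltn_trans (ltn_ord b).
  rewrite /simple_root heightD -scaleN1r.
  have -> : height (-1 *: basis_vec k.+2) = - height (basis_vec k.+2).
    by rewrite /height -sumrN; apply: eq_bigr => m _; rewrite !mxE mulN1r mulrN.
  rewrite !height_basis ?(ltnW lt_kr) // -natrB; last by rewrite leq_sub2l.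
  by rewrite subnS -subn1 subKn // subn_gt0.
by rewrite big_const_nat iter_addr_0 subSS.
Qed.

Lemma finite_root_expressions (xi : 'rV[R]_r.+1) :
  finite_set (root_expressions xi).
Proof.
have [[c0 c0P]|no] := pselect (root_expressions xi !=set0)%classic; last first.
  have -> : root_expressions xi = classical_sets.set0; last exact: finite_set0.
  by rewrite -subset0 => c cP; apply: no; exists c.
pose ht (p : pos_index r) := ((val p).2.+1 - (val p).1)%N.
have ht_gt0 p : (0 < ht p)%N by rewrite subn_gt0 ltnS (valP p).
have htE c : root_expressions xi c -> (\sum_p ht p * c p)%:R = height xi.
  move=> <-; rewrite height_sum natr_sum; apply: eq_bigr => p _.
  by rewrite heightMn height_root -mulrnA.
pose N := (\sum_p ht p * c0 p)%N.
pose f (g : {ffun pos_index r -> 'I_N.+1}) := [ffun p => g p : nat].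
apply: (@sub_finite_set _ _ (f @` [set: {ffun pos_index r -> 'I_N.+1}])%classic); last first.
  by apply: finite_image; exact: finite_finset.
move=> c cP; have leN p : (c p < N.+1)%N.
  rewrite ltnS; have -> : N = (\sum_p ht p * c p)%N.
    by apply/eqP; rewrite -(eqr_nat R) (htE _ c0P) (htE _ cP).
  rewrite (bigD1 p) //=; apply: leq_trans (leq_addr _ _).
  by rewrite leq_pmull.
exists [ffun p => Ordinal (leN p)] => //.
by apply/ffunP => p; rewrite !ffunE.
Qed.

End RootSystemA.

Record fps (R : Type) := FPS { fps_coef :> nat -> R }.
HB.instance Definition _ (R : Type) := [isNew for @fps_coef R].
HB.instance Definition _ (R : choiceType) := [Choice of fps R by <:].

Section FPSRing.
Variable R : idomainType.
Implicit Types f g h : fps R.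

Lemma fpsP f g : (forall n, f n = g n) <-> f = g.
Proof. by split=> [e|->//]; apply: val_inj; apply: funext. Qed.

Definition fps_zero : fps R := FPS (fun=> 0).
Definition fps_opp f : fps R := FPS (fun n => - f n).
Definition fps_add f g : fps R := FPS (fun n => f n + g n).
Definition fps_one : fps R := FPS (fun n => (n == 0%N)%:R).
Definition fps_mul f g : fps R := FPS (fun n => \sum_(i < n.+1) f i * g (n - i)%N).

Fact fps_addA : associative fps_add.
Proof. by move=> f g h; apply/fpsP => n /=; rewrite addrA. Qed.
Fact fps_addC : commutative fps_add.
Proof. by move=> f g; apply/fpsP => n /=; rewrite addrC. Qed.
Fact fps_add0 : left_id fps_zero fps_add.
Proof. by move=> f; apply/fpsP => n /=; rewrite add0r. Qed.
Fact fps_addN : left_inverse fps_zero fps_opp fps_add.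
Proof. by move=> f; apply/fpsP => n /=; rewrite addNr. Qed.
HB.instance Definition _ :=
  GRing.isZmodule.Build (fps R) fps_addA fps_addC fps_add0 fps_addN.

Let trunc N f : {poly R} := \poly_(i < N.+1) f i.

Let trunc_coef N f n : (n <= N)%N -> (trunc N f)`_n = f n.
Proof. by move=> le_nN; rewrite coef_poly ltnS le_nN. Qed.

Let mul_trunc N f g n : (n <= N)%N ->
  fps_mul f g n = (trunc N f * trunc N g)`_n.
Proof.
move=> le_nN; rewrite coefM /=; apply: eq_bigr => i _.
rewrite !trunc_coef //; first by rewrite (leq_trans (leq_subr _ _)).
by rewrite (leq_trans _ le_nN) // -ltnS.
Qed.

Fact fps_mulA : associative fps_mul.
Proof.
move=> f g h; apply/fpsP => n.
transitivity (trunc n f * (trunc n g * trunc n h))`_n.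
  rewrite coefM /=; apply: eq_bigr => i _.
  rewrite -(mul_trunc _ _ (leq_subr _ _)) trunc_coef //.
  by rewrite -ltnS.
rewrite mulrA coefM /=; apply: eq_bigr => i _.
by rewrite -mul_trunc ?trunc_coef ?leq_subr // -ltnS.
Qed.

Fact fps_mulC : commutative fps_mul.
Proof.
by move=> f g; apply/fpsP => n; rewrite !(@mul_trunc n) // mulrC.
Qed.

Fact fps_mul1 : left_id fps_one fps_mul.
Proof.
move=> f; apply/fpsP => n /=; rewrite big_ord_recl /= mul1r subn0.
by rewrite big1 ?addr0 // => i _; rewrite mul0r.
Qed.

Fact fps_mulDl : left_distributive fps_mul fps_add.
Proof.
move=> f g h; apply/fpsP => n /=; rewrite -big_split.
by apply: eq_bigr => i _; rewrite mulrDl.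
Qed.

Fact fps_one_neq0 : fps_one != fps_zero.
Proof. by apply/eqP => /fpsP /(_ 0%N) /= /eqP; rewrite oner_eq0. Qed.

HB.instance Definition _ := GRing.Zmodule_isComNzRing.Build (fps R)
  fps_mulA fps_mulC fps_mul1 fps_mulDl fps_one_neq0.

Definition fps_unit : pred (fps R) := fun f => `[< exists g : fps R, g * f = 1 >].

Definition fps_inv (f : fps R) : fps R :=
  if pselect (exists g : fps R, g * f = 1) is left ex then projT1 (cid ex) else f.

Fact fps_mulV : {in fps_unit, left_inverse 1 fps_inv *%R}.
Proof.
move=> f /asboolP uf; rewrite /fps_inv; case: pselect => // ex.
by case: (cid ex).
Qed.

Fact fps_unitP (f g : fps R) : g * f = 1 -> fps_unit f.
Proof. by move=> gf; apply/asboolP; exists g. Qed.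

Fact fps_inv_out : {in [predC fps_unit], fps_inv =1 id}.
Proof. by move=> f /asboolPn nf; rewrite /fps_inv; case: pselect. Qed.

HB.instance Definition _ := GRing.ComNzRing_hasMulInverse.Build (fps R)
  fps_mulV fps_unitP fps_inv_out.

Fact fps_integral : GRing.integral_domain_axiom (fps R).
Proof.
move=> f g fg0; apply/negPn/negP; rewrite negb_or.
have lead (h : fps R) : h != 0 ->
    exists n, h n != 0 /\ forall i, (i < n)%N -> h i = 0.
  move=> h0; have ex : exists n, h n != 0.
    apply: contrapT => no; move/eqP: h0; apply; apply/fpsP => n /=.
    by apply/eqP/negPn/negP => hn; apply: no; exists n.
  case: (ex_minnP ex) => n hn min; exists n; split=> // i lt_in.
  by apply/eqP/negPn/negP => /min; rewrite leqNgt lt_in.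
case/andP => /lead[m [fm f_lt]] /lead[n [gn g_lt]].
have : (f * g) (m + n)%N = 0 by rewrite fg0.
have lt_m : (m < (m + n).+1)%N by rewrite ltnS leq_addr.
rewrite /= (bigD1 (Ordinal lt_m)) //= addKn big1.
  by rewrite addr0 => /eqP; rewrite mulf_eq0 (negPf fm) (negPf gn).
move=> i ne; have [lt_im|] := ltnP i m; first by rewrite f_lt ?mul0r.
rewrite leq_eqVlt => /orP[/eqP e|lt_mi].
  by case/eqP: ne; apply: val_inj.
rewrite g_lt ?mulr0 // ltn_subLR ?ltn_add2r //.
by rewrite -ltnS.
Qed.

HB.instance Definition _ :=
  GRing.ComUnitRing_isIntegral.Build (fps R) fps_integral.

Definition fpsC (c : R) : fps R := FPS (fun n => if n == 0%N then c else 0).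
Definition fpsX : fps R := FPS (fun n => (n == 1%N)%:R).

End FPSRing.

(* Q[[x,s,t]] is realised as Q[[x]][[s]][[t]].  Fractions such as 1/t are
   taken in its field of fractions. *)

Notation "f %:F" := (FracField.tofrac f) : ring_scope.

Notation fps3 := (fps (fps (fps rat))).

(* The index order is that of x^n s^i t^j, while the coefficients are nested
   with t outermost. *)
Definition fps3_of (c : nat -> nat -> nat -> rat) : fps3 :=
  FPS (fun j => FPS (fun i => FPS (fun n => c n i j))).

Definition var_x : fps3 := fpsC (fpsC (fpsX rat)).
Definition var_s : fps3 := fpsC (fpsX (fps rat)).
Definition var_t : fps3 := fpsX (fps (fps rat)).

Definition genH (F : fieldType) (x s : F) : F :=
  (x * s * (x ^+ 4 * s + 2%:R * x ^+ 3 * s - x ^+ 2 * s + x * s + x ^+ 2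
            + 2%:R * x + 1))
  / ((1 - x - x ^+ 2 - 3%:R * x ^+ 3 - x ^+ 4) * (1 - x * s - (x * s) ^+ 2)).

Definition genP (F : fieldType) (x s : F) : F :=
  (x * s * (x ^+ 4 * s + 3%:R * x ^+ 3 * s + x + 1))
  / ((1 - x - x ^+ 2 - 3%:R * x ^+ 3 - x ^+ 4) * (1 - x * s - (x * s) ^+ 2)).

Definition alternation_series (R : realType) : fps3 :=
  fps3_of (fun r i j =>
    if (1 <= i <= j)%N && (j <= r)%N
    then #|weyl_alternation (highest_root R r) (- pos_root R r i j)|%:R
    else 0).

(* Main.v *)
Require Import Defs.
From mathcomp Require Import all_boot all_order all_fingroup all_algebra.
From mathcomp Require Import finmap boolp classical_sets cardinality reals.
From mathcomp Require Import zify ring.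

Import Order.TTheory GRing.Theory Num.Theory.

Local Open Scope ring_scope.

(** Let t be the inverse of s.  The vector s(lambda + rho) - mu - rho, with lambda the
    highest root and mu = - alpha_{i,j}, is a nonnegative integer combination of
    positive roots exactly when its coordinates sum to 0 and all its prefix sums
    are natural numbers ([kostant_gt0]).  Computing rho explicitly turns this into
    a condition on the sets S_m = t{0, ..., m-1}: for 1 <= m <= r,

      sum S_m - sum {0, ..., m-1} <= [0 in S_m] - [r in S_m] + [i <= m <= j].

    The right-hand side is at most 2, so S_m differs from {0, ..., m-1} by a
    partition of 0, 1 or 2, which leaves four shapes ([shape]).  Adding the next value
    t(m) moves between shapes along a fixed graph ([arrow]), hence the size of the
    alternation set is a number of paths from the shape [Full] to itself
    ([card_weyl_alternation]).

    Outside [i, j] only two shapes are allowed and the paths are counted by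
    Fibonacci numbers, whence the denominators 1 - x - x^2 and
    1 - xst - (xst)^2; inside [i, j] all four shapes are allowed and the
    characteristic polynomial of the graph is 1 - v - v^2 - 3 v^3 - v^4 with
    v = xt.  The restrictions on 0 and r only bite at levels 1, 2, r - 1 and r, and
    all these boundary effects are reproduced exactly by the convention that the
    Fibonacci number of index -1 is 1 ([paths_all]).

    With a = i - 1, b = j - i, c = r - j, the monomial x^r s^i t^j is
    u^(a+1) v^b x^c for u = xst.  The recurrences in a, b and c therefore become linear
    equations between power series ([all_seriesE], [inner_seriesE], [tail_seriesE]),
    and eliminating the auxiliary series gives the rational function
    ([eliminate_series]). *)

(** * Positivity of the partition function *)

Definition psum {R : realType} {r : nat} (m : nat) (v : 'rV[R]_r.+1) : R :=
  \sum_(l < r.+1 | (l < m)%N) v 0 l.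

Lemma psumD {R : realType} {r} m (u v : 'rV[R]_r.+1) :
  psum m (u + v) = psum m u + psum m v.
Proof. by rewrite /psum -big_split; apply: eq_bigr => l _; rewrite mxE. Qed.

Lemma psumN {R : realType} {r} m (v : 'rV[R]_r.+1) :
  psum m (- v) = - psum m v.
Proof. by rewrite /psum -sumrN; apply: eq_bigr => l _; rewrite mxE. Qed.

Lemma psum0 {R : realType} {r} m : psum m (0 : 'rV[R]_r.+1) = 0.
Proof. by rewrite /psum big1 // => l _; rewrite mxE. Qed.

Lemma psumMn {R : realType} {r} m (v : 'rV[R]_r.+1) n :
  psum m (v *+ n) = psum m v *+ n.
Proof. by elim: n => [|n IHn]; rewrite ?psum0 // !mulrS psumD IHn. Qed.

Lemma psum_sum {R : realType} {r} m (I : finType) (F : I -> 'rV[R]_r.+1) :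
  psum m (\sum_i F i) = \sum_i psum m (F i).
Proof. exact: (big_morph _ (@psumD R r m) (@psum0 R r m)). Qed.

Lemma psumS {R : realType} {r} (l : 'I_r.+1) (v : 'rV[R]_r.+1) :
  psum l.+1 v = psum l v + v 0 l.
Proof.
rewrite /psum (bigD1 l) //= addrC; congr (_ + _).
by apply: eq_bigl => k; rewrite ltnS [in RHS]ltn_neqAle andbC.
Qed.

(** The prefix sums are the coordinates in the basis of simple roots, completed by
    the total: this is how vectors are compared below. *)
Lemma psum_inj {R : realType} {r} (u v : 'rV[R]_r.+1) :
  (forall m, (m <= r.+1)%N -> psum m u = psum m v) -> u = v.
Proof.
move=> uv; apply/rowP => l; have := uv _ (ltn_ord l).
by rewrite !psumS uv => [/addrI -> //|]; exact: ltnW.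
Qed.

Lemma psum_basis {R : realType} {r} m k : (0 < k <= r.+1)%N ->
  psum m (basis_vec R r k) = (k <= m)%:R.
Proof.
case: k => // k /= lt_kr; rewrite /psum big_mkcond /=.
rewrite (bigD1 (Ordinal lt_kr)) //= big1 ?addr0 => [|l ne_lk].
  by rewrite mxE eqxx; case: ifP.
rewrite mxE eqSS; case: ifP => // _; case: eqP => // e.
by case/eqP: ne_lk; apply: val_inj.
Qed.

Lemma pos_rootE {R : realType} {r} i j : (i <= j.+1)%N ->
  pos_root R r i j = basis_vec R r i - basis_vec R r j.+1.
Proof.
move=> le_ij; rewrite /pos_root -[RHS]opprB.
rewrite -(telescope_sumr _ le_ij) -sumrN.
by apply: eq_bigr => k _; rewrite opprB.
Qed.

Lemma psum_root {R : realType} {r} m i j : (0 < i <= j)%N -> (j <= r)%N ->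
  psum m (pos_root R r i j) = (i <= m <= j)%:R.
Proof.
move=> /andP[i_gt0 le_ij] le_jr; rewrite pos_rootE; last lia.
rewrite psumD psumN !psum_basis; try lia.
case: (leqP i m) => /=; case: (leqP m j) => /= h1 h2; rewrite ?subr0 ?subrr //; lia.
Qed.

Lemma psum_root_of {R : realType} {r} m (p : pos_index r) :
  psum m (root_of R p) = ((val p).1 < m <= (val p).2.+1)%N%:R.
Proof. by apply: psum_root; [exact: (valP p)|exact: ltn_ord]. Qed.

Lemma kostant_gt0P {R : realType} {r} (xi : 'rV[R]_r.+1) :
  (0 < kostant xi)%N <-> exists c : {ffun pos_index r -> nat},
    \sum_(p : pos_index r) root_of R p *+ c p = xi.
Proof.
have fin := finite_root_expressions xi.
rewrite /kostant cardfs_gt0; split=> [/fset0Pn[c]|[c cE]].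
  by rewrite in_fset_set // inE => cE; exists c.
by apply/fset0Pn; exists c; rewrite in_fset_set // inE.
Qed.

(** The prefix sum at m of a root alpha_{a,b} is [a <= m <= b], so it is natural on
    every combination of positive roots.  Conversely the prefix sums are
    themselves natural coefficients on the simple roots. *)
Lemma kostant_gt0 {R : realType} {r} (xi : 'rV[R]_r.+1) :
  (0 < kostant xi)%N <-> psum r.+1 xi = 0 /\
    forall m, (0 < m <= r)%N -> exists n : nat, psum m xi = n%:R.
Proof.
split.
  move=> /kostant_gt0P[c <-].
  have E m : psum m (\sum_(p : pos_index r) root_of R p *+ c p) =
      (\sum_(p : pos_index r) ((val p).1.+1 <= m <= (val p).2.+1) * c p)%N%:R.
    rewrite psum_sum natr_sum; apply: eq_bigr => p _.
    by rewrite psumMn psum_root_of -mulrnA.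
  split=> [|m _]; last by eexists; exact: E.
  by rewrite E big1 // => p _; rewrite [X in _ && X]ltnS
    [X in _ && X]leqNgt ltn_ord andbF.
move=> [tot0 psum_nat].
have /choice[n nE] : forall m, exists n : nat,
    (0 < m <= r)%N -> psum m xi = n%:R.
  by move=> m; case: (boolP (0 < m <= r)%N) => [/psum_nat[n ?]|?];
    [exists n|exists 0%N].
apply/kostant_gt0P.
(* The simple roots are indexed by the diagonal pairs. *)
exists [ffun p : pos_index r => if (val p).1 == (val p).2 then n (val p).1.+1 else 0%N].
apply: psum_inj => m le_mr.
rewrite psum_sum (eq_bigr (fun p : pos_index r => (if (val p).1 == (val p).2 :> nat then
    ((val p).1.+1 == m)%:R else 0) *+ n m)); last first.
  move=> p _; rewrite psumMn psum_root_of ffunE -val_eqE /=.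
  case: eqP => [->|_]; last by rewrite mul0rn mulr0n.
  by rewrite -eqn_leq; case: eqP => [->|]; rewrite ?mul0rn.
rewrite sumrMnl.
case: (boolP (0 < m <= r)%N) => [m_in|m_out].
  rewrite nE //; have lt_m : (m.-1 < r)%N by lia.
  have le_m : (Ordinal lt_m <= Ordinal lt_m)%N by [].
  rewrite (bigD1 (exist _ (Ordinal lt_m, Ordinal lt_m) le_m)) //= eqxx.
  rewrite prednK ?eqxx; last lia.
  rewrite big1 ?addr0 // => -[[a b] /= le_ab] ne.
  case: eqP => // e1; case: eqP => // e2; case/eqP: ne.
  by apply: val_inj; congr pair; apply: val_inj => /=; lia.
rewrite big1 ?mul0rn => [|p _]; last first.
  case: eqP => // _; case: eqP => // e; case/negP: m_out.
  by rewrite -e /= ltn_ord.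
have [->|->] : m = 0%N \/ m = r.+1 by lia.
  by rewrite /psum big_pred0.
by rewrite tot0.
Qed.

Lemma sum_nat_of_ltn n m : (\sum_(a < n) (a < m) = minn m n)%N.
Proof. by elim: n => [|n IHn]; rewrite ?big_ord0 ?big_ord_recr /= ?IHn; lia. Qed.

Lemma sum_nat_of_geqS n m : (\sum_(b < n) (m <= b.+1) = n - m.-1)%N.
Proof. by elim: n => [|n IHn]; rewrite ?big_ord0 ?big_ord_recr /= ?IHn; lia. Qed.

(** The root alpha_{a+1,b+1} has prefix sum 1 at m exactly when a < m <= b+1, and this
    double inequality already forces a <= b: the sum over pairs factors. *)
Lemma psum_rho {R : realType} {r} m : (m <= r.+1)%N ->
  psum m (rho R r) = (m * (r.+1 - m))%:R / 2%:R.
Proof.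
move=> le_mr; have -> : psum m (rho R r) =
    2%:R^-1 * psum m (\sum_(p : pos_index r) root_of R p).
  by rewrite /psum mulr_sumr; apply: eq_bigr => l _; rewrite mxE.
rewrite mulrC psum_sum; congr (_ / _).
rewrite (eq_bigr (fun p : pos_index r =>
  (((val p).1 < m) * (m <= (val p).2.+1))%N%:R)); last first.
  by move=> p _; rewrite psum_root_of // mulnb.
rewrite -natr_sum; congr (_%:R).
rewrite -(big_sub (fun p : 'I_r * 'I_r => (p.1 <= p.2)%N)
  (fun p => ((p.1 < m) * (m <= p.2.+1))%N)) /=.
transitivity (\sum_(p : 'I_r * 'I_r) ((p.1 < m) * (m <= p.2.+1)))%N.
  rewrite big_mkcond /=; apply: eq_bigr => -[a b] _ /=.
  rewrite unfold_in /=; case: (leqP a b) => // lt_ba.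
  by apply/esym/eqP; rewrite mulnb eqb0; lia.
rewrite -(pair_bigA _ (fun a b : 'I_r => (a < m) * (m <= b.+1)))%N /=.
under eq_bigr do rewrite -big_distrr /= sum_nat_of_geqS.
rewrite -big_distrl /= sum_nat_of_ltn.
case: m le_mr => [|m] le_mr; first by rewrite min0n !mul0n.
rewrite subSS succnK; move: le_mr; rewrite leq_eqVlt => /orP[/eqP[->]|lt_mr].
  by rewrite subnn !muln0.
by rewrite (minn_idPl _).
Qed.

Lemma rhoE {R : realType} {r} (m : 'I_r.+1) :
  rho R r 0 m = r%:R / 2%:R - m%:R.
Proof.
have := ltn_ord m; rewrite ltnS => le_mr.
have -> : rho R r 0 m = psum m.+1 (rho R r) - psum m (rho R r).
  by rewrite psumS addrC addKr.
rewrite !psum_rho ?ltnS //; last exact: leq_trans le_mr _.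
rewrite subSS subSn // !natrM -!natr1 natrB //; by field.
Qed.

(** * From Weyl group elements to words *)

(** The inequality on S_m of the introduction, without truncated subtraction; S lists
    the first values of t, the latest one first. *)
Definition admissible (r i j : nat) (S : seq nat) : bool :=
  (sumn S + (r \in S) <=
   \sum_(l < size S) l + (0%N \in S) + (i <= size S <= j))%N.

(** A word is read from left to right, S holding the letters already read; every
    nonempty prefix must be admissible. *)
Fixpoint adm_word (r i j : nat) (S w : seq nat) : bool :=
  if w is a :: w' then
    [&& a \notin S, admissible r i j (a :: S) & adm_word r i j (a :: S) w']
  else true.

Lemma adm_wordP r i j S w :
  adm_word r i j S w <->
  [/\ uniq w, all (fun a => a \notin S) w &
    forall m, (0 < m <= size w)%N -> admissible r i j (catrev (take m w) S)].
Proof.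
elim: w S => [|a w IHw] S /=.
  by split=> // _; split=> // m; lia.
split=> [/and3P[aS adm_a /IHw[uw wS adm_w]]|[/andP[aw uw] /andP[aS wS] adm_w]].
  split.
  - rewrite uw andbT; apply/negP => /(allP wS); by rewrite inE eqxx.
  - rewrite aS; apply/allP => b /(allP wS); by rewrite inE negb_or => /andP[].
  - case=> [|[|m]] // le_m; first by rewrite /= take0.
    exact: adm_w.
apply/and3P; split=> //; first by have := adm_w 1%N; rewrite /= take0; apply.
apply/IHw; split=> //.
  apply/allP => b bw; rewrite inE negb_or (allP wS _ bw) andbT.
  by apply: contraNneq aw => <-.
by move=> m /andP[m_gt0 le_m]; apply: (adm_w m.+1).
Qed.

Lemma take_enum_ord n m : (m <= n)%N ->
  take m (enum 'I_n) = [seq l : 'I_n <- enum 'I_n | (l < m)%N].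
Proof.
move=> le_mn; apply: (inj_map val_inj); rewrite map_take val_enum_ord.
have -> : [seq val l | l : 'I_n <- enum 'I_n & (l < m)%N] =
    [seq l <- iota 0 n | (l < m)%N].
  by rewrite -val_enum_ord filter_map.
rewrite take_iota.
by rewrite (minn_idPl le_mn) -[in RHS](add0n m) filter_iota_ltn.
Qed.

Definition perm_word {n} (t : 'S_n) : seq nat := [seq val (t l) | l <- enum 'I_n].

Lemma perm_word_uniq {n} (t : 'S_n) : uniq (perm_word t).
Proof.
by rewrite map_inj_uniq ?enum_uniq // => k l /val_inj/perm_inj.
Qed.

Lemma big_perm_word {n} (t : 'S_n) m (F : nat -> nat) : (m <= n)%N ->
  (\sum_(a <- take m (perm_word t)) F a = \sum_(l < n | l < m) F (t l))%N.
Proof.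
by move=> le_mn; rewrite -map_take big_map take_enum_ord // big_filter big_enum_cond.
Qed.

Lemma mem_take_perm_word {n} (t : 'S_n) m a : (m <= n)%N ->
  (a \in take m (perm_word t)) = (\sum_(l < n | l < m) (val (t l) == a))%N :> nat.
Proof.
move=> le_mn; rewrite -(big_perm_word t m (fun b => b == a)) //.
rewrite -count_uniq_mem ?take_uniq ?perm_word_uniq // -sum1_count.
by rewrite [in LHS]big_mkcond /=; apply: eq_bigr => b _; case: eqP.
Qed.

(** In coordinates, highest_root + rho has entry [k = 0] - [k = r] + r/2 - k at k;
    the constants r/2 cancel against those of rho. *)
Lemma psum_weyl_act {R : realType} {r} m i j (t : 'S_r.+1) :
    (0 < i <= j)%N -> (j <= r)%N ->
  psum m (weyl_act t^-1%g (highest_root R r + rho R r)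
          - - pos_root R r i j - rho R r) =
  (\sum_(l < r.+1 | l < m) (val (t l) == 0) + \sum_(l < r.+1 | l < m) l
     + (i <= m <= j))%N%:R
  - (\sum_(l < r.+1 | l < m) t l + \sum_(l < r.+1 | l < m) (val (t l) == r))%N%:R.
Proof.
move=> ij le_jr; rewrite opprK addrAC psumD psum_root // !natrD !natr_sum.
have -> : psum m (weyl_act t^-1%g (highest_root R r + rho R r) - rho R r) =
    \sum_(l < r.+1 | (l < m)%N) (((val (t l) == 0%N)%:R + l%:R)
      - ((val (t l))%:R + (val (t l) == r)%:R)).
  apply: eq_bigr => l _.
  have addE (u v : 'rV[R]_r.+1) k : (u + v) 0 k = u 0 k + v 0 k by rewrite mxE.
  have oppE (u : 'rV[R]_r.+1) k : (- u) 0 k = - u 0 k by rewrite mxE.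
  have actE (u : 'rV[R]_r.+1) : weyl_act t^-1%g u 0 l = u 0 (t l).
    by rewrite /weyl_act -col_permE mxE.
  have basisE k k' : basis_vec R r k 0 k' = (k'.+1 == k)%:R by rewrite mxE.
  rewrite addE actE addE oppE !rhoE -[highest_root R r]/(pos_root R r 1 r).
  rewrite pos_rootE // addE oppE !basisE !eqSS; ring.
rewrite sumrB !big_split /=; ring.
Qed.

(** Parametrising by the inverse t makes the prefix sums depend on the prefixes of the
    word of t.  At the full length r+1 both sides of the admissibility inequality agree up
    to [i <= r+1 <= j] = 0, so it holds there automatically. *)
Lemma mem_weyl_alternation {R : realType} {r} i j (t : 'S_r.+1) :
    (0 < i <= j)%N -> (j <= r)%N ->
  (t^-1%g \in weyl_alternation (highest_root R r) (- pos_root R r i j)) =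
  adm_word r i j [::] (perm_word t).
Proof.
move=> ij le_jr; have sz : size (perm_word t) = r.+1 by rewrite size_map size_enum_ord.
have admE m : (m <= r.+1)%N -> admissible r i j (catrev (take m (perm_word t)) [::]) =
   (\sum_(l < r.+1 | l < m) t l + \sum_(l < r.+1 | l < m) (val (t l) == r)
    <= \sum_(l < r.+1 | l < m) (val (t l) == 0) + \sum_(l < r.+1 | l < m) l
     + (i <= m <= j))%N.
  move=> le_m; rewrite /admissible -/(rev _) size_rev sumn_rev !mem_rev.
  rewrite size_takel ?sz // !mem_take_perm_word // sumnE big_perm_word //.
  rewrite (big_ord_widen _ (fun l => l) le_m).
  by rewrite [X in (_ <= X + _)%N]addnC.
(* At the full length both sides sum over all of {0, ..., r}. *)
have tot : (\sum_(l < r.+1) t l + \sum_(l < r.+1) (val (t l) == r)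
    = \sum_(l < r.+1) (val (t l) == 0) + \sum_(l < r.+1) l)%N.
  have reT (F : 'I_r.+1 -> nat) : (\sum_l F (t l) = \sum_l F l)%N.
    by rewrite [RHS](reindex_inj (@perm_inj _ t)).
  rewrite (reT (@nat_of_ord _)) (reT (fun l => (val l == r) : nat)).
  rewrite (reT (fun l => (val l == 0%N) : nat)).
  rewrite addnC; congr addn.
  rewrite (bigD1 ord_max) //= eqxx big1 => [|l ne]; last first.
    by apply/eqP; rewrite eqb0; apply: contra ne => /eqP e; apply/eqP/val_inj.
  by rewrite (bigD1 ord0) //= big1 // => l ne; apply/eqP; rewrite eqb0.
rewrite inE; apply/idP/idP => [/kostant_gt0[_ nat_psum]|/adm_wordP[_ _ adm]].
  apply/adm_wordP; split=> [||m].
  - exact: perm_word_uniq.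
  - by apply/allP.
  rewrite sz => /andP[m_gt0 le_m]; rewrite admE //.
  move: le_m; rewrite leq_eqVlt => /orP[/eqP->|lt_m].
    have ltT : (fun l : 'I_r.+1 => (l < r.+1)%N) =1 xpredT by move=> l; rewrite ltn_ord.
    rewrite !(eq_bigl _ _ ltT) tot; exact: leq_addr.
  have [|n] := nat_psum m; first by rewrite m_gt0.
  by rewrite psum_weyl_act // => /eqP; rewrite subr_eq -natrD eqr_nat => /eqP->;
    rewrite leq_addl.
apply/kostant_gt0; split.
  have ltT : (fun l : 'I_r.+1 => (l < r.+1)%N) =1 xpredT by move=> l; rewrite ltn_ord.
  rewrite psum_weyl_act // !(eq_bigl _ _ ltT) tot.
  have -> : (i <= r.+1 <= j)%N = false by lia.
  by rewrite addn0 subrr.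
move=> m /andP[m_gt0 le_m]; rewrite psum_weyl_act //.
have le_m1 := leqW le_m; have := adm m; rewrite sz m_gt0 le_m1 admE // => /(_ isT) le.
by eexists; rewrite -natrB.
Qed.

(** * Shapes of prefixes *)

(** The four possible sets of the first m values: with excess 0 the interval
    {0, ..., m-1} ([Full]); with excess 1 its last element m-1 replaced by m ([Gap]);
    with excess 2 either m-1 replaced by m+1 ([Jump]) or m-2 replaced by m
    ([Deep]). *)
Inductive shape := Full | Gap | Jump | Deep.

Definition in_shape (m : nat) (X : shape) (l : nat) : bool :=
  match X with
  | Full => l < m
  | Gap => (l < m.-1) || (l == m)
  | Jump => (l < m.-1) || (l == m.+1)
  | Deep => (l < m.-2) || (l == m.-1) || (l == m)
  end%N.

Definition excess (X : shape) : nat :=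
  match X with Full => 0 | Gap => 1 | Jump => 2 | Deep => 2 end.

(** The levels m at which the shape exists inside {0, ..., n-1}. *)
Definition shape_range (n m : nat) (X : shape) : bool :=
  match X with
  | Full => m <= n
  | Gap => 0 < m < n
  | Jump => 0 < m < n.-1
  | Deep => 1 < m < n
  end%N.

Definition shape_ok (r i j m : nat) (X : shape) : bool :=
  shape_range r.+1 m X &&
  (excess X + in_shape m X r <= in_shape m X 0 + (i <= m <= j))%N.

Definition arrow (X Y : shape) : bool :=
  match X, Y with
  | Full, (Full | Gap | Jump) | Gap, (Full | Deep)
  | Jump, (Gap | Deep) | Deep, Full => true
  | _, _ => false
  end.

Definition shapes := [:: Full; Gap; Jump; Deep].

Fixpoint paths (r i j k m : nat) (X : shape) : nat :=
  if k is k'.+1 then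
    \sum_(Y <- shapes | arrow X Y && shape_ok r i j m.+1 Y)
      paths r i j k' m.+1 Y
  else 1.

Fixpoint count_adm_words (r i j k : nat) (S : seq nat) : nat :=
  if k is k'.+1 then
    \sum_(a < r.+1 | (val a \notin S) && admissible r i j (val a :: S))
      count_adm_words r i j k' (val a :: S)
  else 1.

Definition new_value (m : nat) (X Y : shape) : nat := m + excess Y - excess X.

Definition has_shape (n m : nat) (X : shape) (S : seq nat) : Prop :=
  [/\ shape_range n m X, size S = m,
      (sumn S = \sum_(l < m) l + excess X)%N & S =i in_shape m X].

(** Passing from shape X to shape Y at level m adds the value m + excess Y - excess X, by
    comparing sums.  The inequality bounds the new excess by 2, which leaves few
    candidate values; each is checked separately. *)
Lemma next_shapeP r i j m X S a :
    (m < r.+1)%N -> has_shape r.+1 m X S ->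
  [&& a < r.+1, a \notin S & admissible r i j (a :: S)]%N =
  (a \in [seq new_value m X Y | Y <- shapes & arrow X Y && shape_ok r i j m.+1 Y]).
Proof.
move=> lt_m [rg sz sm memS].
have hasE (s : seq shape) :
    (a \in [seq new_value m X Y | Y <- s & arrow X Y && shape_ok r i j m.+1 Y])
    = has (fun Y => [&& a == new_value m X Y, arrow X Y & shape_ok r i j m.+1 Y]) s.
  elim: s => //= Y s <-; case: ifP => _; by rewrite ?inE ?andbT ?andbF.
rewrite hasE /admissible /= !inE sz sm !memS big_ord_recr /= !unfold_in.
(* The sum of {0, ..., m-1} cancels, leaving only the excess. *)
have -> c e (b b' d : nat) :
    (a + (c + e) + b <= c + m + b' + d)%N = (a + e + b <= m + b' + d)%N.
  lia.
rewrite /shape_ok /new_value.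
move: (nat_of_bool (i <= m.+1 <= j)%N) (leq_b1 (i <= m.+1 <= j)%N) => d d1.
clear memS sm sz hasE.
case: X rg => /= rg; rewrite ?orbF ?addn0 ?subn0.
- have [->|n1] := eqVneq a m; first by lia.
  have [->|n2] := eqVneq a m.+1; first by lia.
  have [->|n3] := eqVneq a m.+2; first by lia.
  lia.
- have [->|n1] := eqVneq a m.-1; first by lia.
  have [->|n2] := eqVneq a m.+1; first by lia.
  lia.
- have [->|n1] := eqVneq a m.-1; first by lia.
  have [->|n2] := eqVneq a m; first by lia.
  lia.
- have [->|n1] := eqVneq a m.-2; first by lia.
  lia.
Qed.

Lemma has_shape_next r i j m X S Y :
    has_shape r.+1 m X S -> shape_ok r i j m.+1 Y ->
    arrow X Y ->
  has_shape r.+1 m.+1 Y (new_value m X Y :: S).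
Proof.
move=> [rg sz sm memS] /andP[rgY _] XY; rewrite /new_value; split=> //=.
- by rewrite sz.
- rewrite sm big_ord_recr /=; move: (\sum_(l < m) l)%N => c.
  case: X XY rg {memS sm} => //=; case: Y rgY => //=; lia.
- move=> l; rewrite inE memS !unfold_in.
  case: X XY rg {memS sm} => //=; case: Y rgY => //=; lia.
Qed.

(** By [next_shapeP], the letters that may follow a prefix of shape X are in bijection
    with the allowed arrows out of X. *)
Lemma count_adm_words_paths r i j k m X S :
    (m + k = r.+1)%N -> has_shape r.+1 m X S ->
  count_adm_words r i j k S = paths r i j k m X.
Proof.
elim: k m X S => [|k IHk] m X S //= mk hS.
pose G a := count_adm_words r i j k (a :: S).
pose P a := (a \notin S) && admissible r i j (a :: S).
pose s := [seq new_value m X Y | Y <- shapes & arrow X Y && shape_ok r i j m.+1 Y].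
have us : uniq s.
  rewrite /s /new_value; have [rg _ _ _] := hS; clear -rg.
  by case: X rg => /= rg; do ![case: ifP => _ /=]; rewrite ?inE //; lia.
transitivity (\sum_(a <- s) G a)%N.
  rewrite -(big_mkord P G) -big_filter; apply: perm_big.
  apply: uniq_perm => // [|a]; first by rewrite filter_uniq ?iota_uniq.
  rewrite mem_filter mem_iota add0n -(@next_shapeP r i j m X S) //; last lia.
  by rewrite /P /= subn0 andbC andbA.
rewrite big_map big_filter /G.
apply: eq_bigr => Y /andP[XY okY].
by apply: IHk; [lia|exact: has_shape_next hS okY XY].
Qed.

Lemma card_adm_word r i j k S :
  #|[set w : k.-tuple 'I_r.+1 | adm_word r i j S [seq val a | a <- w]]| =
  count_adm_words r i j k S.
Proof.
elim: k S => [|k IHk] S /=.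
  rewrite -[RHS](card_tuple 0 'I_r.+1); apply: eq_card => w.
  by rewrite inE tuple0.
rewrite -sum1dep_card.
rewrite (reindex (fun p : 'I_r.+1 * k.-tuple 'I_r.+1 => [tuple of p.1 :: p.2])) /=;
  last first.
  exists (fun w => (thead w, [tuple of behead w])) => [[a w] _|w _] /=.
    by rewrite theadE; congr pair; apply: val_inj.
  by rewrite [RHS]tuple_eta.
transitivity (\sum_(a < r.+1) \sum_(w : k.-tuple 'I_r.+1)
   (if (val a \notin S) && admissible r i j (val a :: S) then
     adm_word r i j (val a :: S) [seq val b | b <- w] : nat else 0))%N.
  rewrite pair_bigA big_mkcond; apply: eq_bigr => -[a w] _ /=.
  by rewrite andbA; case: (_ && admissible _ _ _ _); case: (adm_word _ _ _ _ _).
rewrite [RHS]big_mkcond /=; apply: eq_bigr => a _; case: ifP => _; last by rewrite big1.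
rewrite -IHk -sum1dep_card [RHS]big_mkcond; apply: eq_bigr => w _.
by case: (adm_word _ _ _ _ _).
Qed.

Lemma card_weyl_alternation {R : realType} {r} i j :
    (0 < i <= j)%N -> (j <= r)%N ->
  #|weyl_alternation (highest_root R r) (- pos_root R r i j)| = paths r i j r.+1 0 Full.
Proof.
move=> ij le_jr.
rewrite -(@count_adm_words_paths r i j r.+1 0 Full [::]) // -?card_adm_word; last first.
  by split=> //=; rewrite big_ord0.
pose word (t : 'S_r.+1) : r.+1.-tuple 'I_r.+1 := [tuple t l | l < r.+1].
have wordE t : [seq val a | a <- word t] = perm_word t by rewrite /= -map_comp.
have word_inj : injective word.
  move=> t u e; apply/permP => l.
  by rewrite -(tnth_mktuple t l) -/(word t) e tnth_mktuple.
rewrite -(card_imset _ (@invg_inj _)) -(card_imset _ word_inj).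
apply: eq_card => w; rewrite inE; apply/imsetP/idP.
  move=> [t /imsetP[u uA ->] ->]; rewrite wordE -(@mem_weyl_alternation R) //.
  by rewrite invgK.
move=> adm; have uw : injective (tnth w).
  apply/tuple_uniqP; have /adm_wordP[uw _ _] := adm.
  by rewrite (map_inj_uniq val_inj) in uw.
exists (perm uw); last first.
  by apply: eq_from_tnth => l; rewrite tnth_mktuple permE.
apply/imsetP; exists (perm uw)^-1%g; last by rewrite invgK.
rewrite mem_weyl_alternation // -wordE.
by have -> : word (perm uw) = w by apply: eq_from_tnth => l; rewrite tnth_mktuple permE.
Qed.

(** * Counting the paths *)

Fixpoint fib (n : nat) : nat :=
  match n with 0 => 0 | 1 => 1 | (n'.+1 as p).+1 => fib p + fib n' end%N.

Lemma fibSS n : (fib n.+2 = fib n.+1 + fib n)%N. Proof. by []. Qed.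

(** Number of completions from each shape at level j when c = r - j further
    levels remain.  For c = 0 these are not actual counts: they are the values which
    extend the recurrences ([Jump] standing for the Fibonacci number of index -1)
    and which give the right counts one level earlier. *)
Definition tail_paths (c : nat) (X : shape) : nat :=
  match X with
  | Full => fib c.+1
  | Gap | Deep => fib c
  | Jump => if c is c'.+1 then fib c' else 1
  end%N.

(** Paths through b more unrestricted levels, weighted by [tail_paths] at the end. *)
Fixpoint inner_paths (c b : nat) (X : shape) : nat :=
  if b is b'.+1 then \sum_(Y <- shapes | arrow X Y) inner_paths c b' Y
  else tail_paths c X.

(** Number of ways to reach each shape at level i = a + 1; the mirror image of
    [tail_paths] under the symmetry that exchanges [Jump] and [Deep], with the
    same convention for a = 0. *)
Definition head_paths (a : nat) (X : shape) : nat :=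
  match X with
  | Full => fib a.+1
  | Gap | Jump => fib a
  | Deep => if a is a'.+1 then fib a' else 1
  end%N.

Definition all_paths (a b c : nat) : nat :=
  \sum_(X <- shapes) head_paths a X * inner_paths c b X.

Lemma sum_arrow X (P : pred shape) (F : shape -> nat) :
  (\sum_(Y <- shapes | arrow X Y && P Y) F Y =
   match X with
   | Full => P Full * F Full + P Gap * F Gap + P Jump * F Jump
   | Gap => P Full * F Full + P Deep * F Deep
   | Jump => P Gap * F Gap + P Deep * F Deep
   | Deep => P Full * F Full
   end)%N.
Proof.
rewrite !big_cons !big_nil.
by case: X => /=; do ![case: ifP => _]; lia.
Qed.

Lemma pathsS r i j k m X :
  paths r i j k.+1 m X =
  (\sum_(Y <- shapes | arrow X Y && shape_ok r i j m.+1 Y) paths r i j k m.+1 Y)%N.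
Proof. by []. Qed.

Lemma full_ok r i j m : (0 < m <= r.+1)%N -> shape_ok r i j m Full.
Proof. by rewrite /shape_ok /=; lia. Qed.

Lemma gap_ok r i j m : (1 < m)%N ->
  shape_ok r i j m Gap = (m <= r)%N && ((m < r) || (i <= m <= j))%N.
Proof. by rewrite /shape_ok /=; lia. Qed.

Lemma jump_ok r i j m : (1 < m)%N ->
  shape_ok r i j m Jump = (m.+1 < r)%N && (i <= m <= j)%N.
Proof. by rewrite /shape_ok /=; lia. Qed.

Lemma deep_ok r i j m : (2 < m)%N ->
  shape_ok r i j m Deep = (m < r)%N && (i <= m <= j)%N.
Proof. by rewrite /shape_ok /=; lia. Qed.

Lemma gap_ok1 r i j : shape_ok r i j 1 Gap = (1 < r)%N && (i <= 1 <= j)%N.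
Proof. by rewrite /shape_ok /=; lia. Qed.

Lemma jump_ok1 r i j : shape_ok r i j 1 Jump = false.
Proof. by rewrite /shape_ok /=; lia. Qed.

Lemma deep_ok2 r i j : shape_ok r i j 2 Deep = false.
Proof. by rewrite /shape_ok /=; lia. Qed.

Lemma gap_range r i j : shape_ok r i j r.+1 Gap = false.
Proof. by rewrite /shape_ok /=; lia. Qed.

Lemma jump_range r i j : shape_ok r i j r.+1 Jump = false.
Proof. by rewrite /shape_ok /=; lia. Qed.

Lemma deep_range r i j : shape_ok r i j r.+1 Deep = false.
Proof. by rewrite /shape_ok /=; lia. Qed.

Lemma paths_last r i j X : paths r i j 1 r X = (if X is Jump then 0 else 1)%N.
Proof.
rewrite /= sum_arrow full_ok; last lia.
by rewrite gap_range jump_range deep_range; case: X.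
Qed.

(** After j only [Full] and [Gap] are allowed, and [Gap] must return to [Full]: this is
    the Fibonacci recurrence.  Its boundary value comes
    from [Gap] being forbidden at level r. *)
Lemma paths_after r i j c m X : (0 < m)%N -> (j <= m)%N -> (r = m + c.+1)%N ->
  paths r i j c.+2 m X = tail_paths c.+1 X.
Proof.
elim: c m X => [|c IHc] m X m_gt0 le_jm rE;
  rewrite pathsS sum_arrow full_ok ?gap_ok ?jump_ok; try lia.
  have -> : m.+1 = r by lia.
  have -> : shape_ok r i j r Deep = false.
    by move: rE le_jm; rewrite /shape_ok /=; lia.
  rewrite !paths_last; case: X => /=; lia.
rewrite !IHc; try lia.
have -> : shape_ok r i j m.+1 Deep = false.
  by move: rE le_jm; rewrite /shape_ok /=; lia.
case: X => /=; lia.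
Qed.

Lemma sum_arrowT X (F : shape -> nat) :
  (\sum_(Y <- shapes | arrow X Y) F Y =
   match X with
   | Full => F Full + F Gap + F Jump
   | Gap => F Full + F Deep
   | Jump => F Gap + F Deep
   | Deep => F Full
   end)%N.
Proof.
rewrite (eq_bigl (fun Y => arrow X Y && predT Y)) => [|Y]; last by rewrite andbT.
by rewrite sum_arrow !mul1n.
Qed.

Lemma inner_pathsS c b X :
  inner_paths c b.+1 X =
   (match X with
   | Full => inner_paths c b Full + inner_paths c b Gap + inner_paths c b Jump
   | Gap => inner_paths c b Full + inner_paths c b Deep
   | Jump => inner_paths c b Gap + inner_paths c b Deep
   | Deep => inner_paths c b Full
   end)%N.
Proof. exact: sum_arrowT. Qed.

(** Two restrictions disturb the free recurrence.  [Deep] is forbidden at level 2 because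
    0 is then missing; the hypothesis at m = 1 keeps paths away from it.
    [Jump] is forbidden at level r - 1, and [Jump] and [Deep] at level r, because r is
    already present; there the values of [tail_paths] vanish or, when j = r,
    compensate each other in the sum. *)
Lemma paths_inner r i j b c m X :
    (0 < m)%N -> (i <= m.+1)%N -> (m + b = j)%N -> (j + c = r)%N ->
    shape_ok r i j m X -> (m = 1%N -> X = Full) ->
    ((b + c = 0)%N -> X = Full) ->
  paths r i j (b + c).+1 m X = inner_paths c b X.
Proof.
elim: b m X => [|b IHb] m X m_gt0 le_im mb jc okX m1 bc.
  case: c jc bc => [|c] jc bc.
    by rewrite bc //; have -> : m = r by [lia]; rewrite paths_last.
  by apply: paths_after; lia.
rewrite addSn pathsS sum_arrow inner_pathsS.
(* From level r - 1 to j = r, where the values of [tail_paths] are not counts. *)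
have [bc0|bc_gt0] := posnP (b + c).
  have [-> ->] : b = 0%N /\ c = 0%N by lia.
  have mr : m.+1 = r by lia.
  rewrite mr !paths_last full_ok ?gap_ok ?jump_ok; try lia.
  have -> : shape_ok r i j r Deep = false by move: jc mb bc0; rewrite /shape_ok /=; lia.
  case: X okX m1 {bc} => //=; try lia.
  by rewrite /shape_ok /=; lia.
have EF : paths r i j (b + c).+1 m.+1 Full = inner_paths c b Full.
  by apply: IHb; rewrite ?full_ok //; lia.
have EG : paths r i j (b + c).+1 m.+1 Gap = inner_paths c b Gap.
  by apply: IHb; rewrite ?gap_ok //; lia.
have EJ : (shape_ok r i j m.+1 Jump * paths r i j (b + c).+1 m.+1 Jump
    = inner_paths c b Jump)%N.
  case: (boolP (shape_ok r i j m.+1 Jump)) => [ok|].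
    by rewrite mul1n; apply: IHb; rewrite //; lia.
  rewrite jump_ok; last lia.
  (* Jump fails at level r - 1, which is j if c = 1 and j - 1 if c = 0. *)
  move=> nok; have [[bE cE]|[bE cE]] : (b = 0 /\ c = 1 \/ b = 1 /\ c = 0)%N by lia.
    by rewrite bE cE.
  by rewrite bE cE inner_pathsS.
have ED : (m != 1)%N ->
    (shape_ok r i j m.+1 Deep * paths r i j (b + c).+1 m.+1 Deep
    = inner_paths c b Deep)%N.
  move=> m_neq1; rewrite deep_ok; last lia.
  have -> : (m.+1 < r)%N && (i <= m.+1 <= j)%N by lia.
  rewrite mul1n; apply: IHb; rewrite ?deep_ok //; lia.
rewrite full_ok; last lia.
rewrite gap_ok; last lia.
have -> : (m.+1 <= r)%N && ((m.+1 < r) || (i <= m.+1 <= j))%N by lia.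
rewrite !mul1n EF EG EJ.
case: X okX m1 bc => // okX m1 _; rewrite ED //; by apply/eqP => /m1.
Qed.

(** Before i the recurrence is Fibonacci in the distance d = i - 1 - m, starting from
    the two shapes possible at level i - 1. *)
Lemma paths_before r i j b c d m X :
    (0 < m)%N -> (m + d.+1 = i)%N -> (i + b = j)%N -> (j + c = r)%N ->
    (X = Full) \/ (X = Gap /\ (1 < m)%N) ->
  (paths r i j (d + (b.+1 + c)).+1 m X =
   match X, d with
   | Full, _ => fib d.+1 * inner_paths c b.+1 Full + fib d * inner_paths c b.+1 Gap
   | _, 0 => inner_paths c b.+1 Gap
   | _, d'.+1 => fib d * inner_paths c b.+1 Full + fib d' * inner_paths c b.+1 Gap
   end)%N.
Proof.
elim: d m X => [|d IHd] m X m_gt0 mi ib jc X_m.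
  rewrite add0n paths_inner; try lia.
  - by case: X_m => [->|[->]] //; rewrite mul1n mul0n addn0.
  - by case: X_m => [->|[-> m_gt1]]; rewrite ?full_ok ?gap_ok //; lia.
  - by case: X_m => // -[_]; lia.
have nd : (i <= m.+1)%N = false by lia.
rewrite addSn pathsS sum_arrow full_ok ?gap_ok ?jump_ok; try lia.
have -> : shape_ok r i j m.+1 Deep = false by rewrite /shape_ok /= nd; lia.
have -> : (m.+1 <= r)%N && ((m.+1 < r) || (i <= m.+1 <= j))%N by lia.
rewrite nd andbF !mul0n !addn0 !mul1n.
rewrite (IHd _ Full) //; try lia; last by left.
case: X_m => [->|[-> _]] //.
rewrite (IHd _ Gap) //; try lia; last by right; split=> //; lia.
case: d {IHd mi nd} => [|d]; first by rewrite /=; lia.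
by rewrite !fibSS !mulnDl; lia.
Qed.

(** For i > 1 the first value must be 0, and [paths_before] applies from level 1.
    For i = 1 the path may start with [Gap], from which only [Full] can follow; this
    is also the only move out of [Deep], hence the weights (1, 0, 0, 1) given by
    [head_paths] at a = 0. *)
Lemma paths_all r i j a b c : i = a.+1 -> (i + b = j)%N -> (j + c = r)%N ->
  paths r i j r.+1 0 Full = all_paths a b c.
Proof.
move=> iE ib jc; rewrite pathsS sum_arrow full_ok ?gap_ok1 ?jump_ok1; last lia.
rewrite /all_paths /shapes !big_cons big_nil mul1n mul0n !addn0.
case: a iE => [|a] iE.
  have -> : paths r i j r 1 Full = inner_paths c b Full.
    have {2}-> : r = (b + c).+1 by lia.
    by apply: paths_inner => //; rewrite ?full_ok //; lia.
  rewrite /= !mul0n !mul1n !add0n; congr addn.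
  have [bc0|bc_gt0] := posnP (b + c).
    have [-> ->] : b = 0%N /\ c = 0%N by lia.
    by have -> : (1 < r)%N = false by lia.
  have -> : (1 < r)%N && (i <= 1 <= j)%N by lia.
  have {2}-> : r = (b + c).-1.+2 by lia.
  rewrite mul1n pathsS sum_arrow full_ok ?deep_ok2; last lia.
  rewrite mul0n addn0 mul1n.
  case: b ib bc_gt0 => [|b] ib bc_gt0; last first.
    by rewrite inner_pathsS -(paths_inner r i j _ _ 2 Full) ?full_ok //; lia.
  case: c jc bc_gt0 => [|[|c]] // jc _.
    by have -> : r = 2%N by [lia]; rewrite paths_last.
  by rewrite add0n paths_after //; lia.
have -> : (i <= 1 <= j)%N = false by lia.
rewrite andbF mul0n addn0.
have {2}-> : r = (a + (b.+1 + c)).+1 by lia.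
rewrite (paths_before r i j b c a 1 Full); try lia; last by left.
rewrite !inner_pathsS /=; lia.
Qed.

(** * Linear equations between the generating series *)

Lemma fpsX_mulE (R : idomainType) (f : fps R) n :
  (fpsX R * f) n = if n is n'.+1 then f n' else 0.
Proof.
case: n => [|n]; first by rewrite [LHS]big_ord1 /= mul0r.
rewrite [LHS]big_ord_recl /= mul0r add0r big_ord_recl /= mul1r subSS subn0.
by rewrite big1 ?addr0 // => i _; rewrite mul0r.
Qed.

Lemma fpsC_mulE (R : idomainType) (a : R) (f : fps R) n :
  (fpsC a * f) n = a * f n.
Proof.
rewrite [LHS]big_ord_recl /= subn0 big1 ?addr0 // => i _.
by rewrite mul0r.
Qed.

(** The series of the g a b c u^(a+1) v^b x^c with u = xst and v = xt, so that the
    multiplications by u, v and x are the shifts in a, b and c. *)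
Definition box_series (g : nat -> nat -> nat -> rat) : fps3 :=
  fps3_of (fun n i j =>
    if (1 <= i <= j)%N && (j <= n)%N then g i.-1 (j - i)%N (n - j)%N else 0).

Lemma eq_box_series g h : (forall a b c, g a b c = h a b c) ->
  box_series g = box_series h.
Proof.
move=> gh; apply/fpsP => j; apply/fpsP => i; apply/fpsP => n /=.
by rewrite gh.
Qed.

Lemma box_seriesD g h :
  box_series g + box_series h = box_series (fun a b c => g a b c + h a b c).
Proof.
apply/fpsP => j; apply/fpsP => i; apply/fpsP => n /=.
by case: ifP; rewrite ?addr0.
Qed.

Lemma var_x_box g :
  var_x * box_series g =
  box_series (fun a b c => if c is c'.+1 then g a b c' else 0).
Proof.
apply/fpsP => j; apply/fpsP => i; apply/fpsP => n.
rewrite /var_x !fpsC_mulE fpsX_mulE /=; case: n => [|n].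
  by case: ifP => // _; rewrite sub0n.
case: (boolP ((0 < i <= j) && (j <= n)))%N => [/andP[-> le_jn]|nin] /=.
  by rewrite (leqW le_jn) subSn.
case: ifP => // h; have -> : (n.+1 - j = 0)%N by lia.
by [].
Qed.

Lemma var_xt_box g :
  var_x * var_t * box_series g =
  box_series (fun a b c => if b is b'.+1 then g a b' c else 0).
Proof.
apply/fpsP => j; apply/fpsP => i; apply/fpsP => n.
rewrite -mulrA /var_x !fpsC_mulE fpsX_mulE /var_t fpsX_mulE.
case: n j => [|n] [|j] //=; try by [case: ifP => //; lia].
rewrite subSS ltnS.
case: (boolP ((0 < i <= j) && (j <= n)))%N => [|nin] /=.
  by move=> /andP[/andP[i_gt0 le_ij] ->]; rewrite i_gt0 (leqW le_ij) subSn.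
case: ifP => // h; have -> : (j.+1 - i = 0)%N by lia.
by [].
Qed.

Lemma var_xst_box g :
  var_x * var_s * var_t * box_series g =
  box_series (fun a b c => if a is a'.+1 then g a' b c else 0).
Proof.
apply/fpsP => j; apply/fpsP => i; apply/fpsP => n.
rewrite -!mulrA !fpsC_mulE !fpsX_mulE.
case: n i j => [|n] [|i] [|j] //=; try by [case: ifP => //; lia].
rewrite !subSS !ltnS; case: i => [|i] //=.
by case: ifP.
Qed.

Definition inner_series (X : shape) : fps3 :=
  box_series (fun a b c => if a is 0%N then (inner_paths c b X)%:R else 0).

Definition tail_series : fps3 :=
  box_series (fun a b c =>
    if (a, b) is (0%N, 0%N) then (fib c.+1)%:R else 0).

Lemma var_xstE : var_x * var_s * var_t =
  box_series (fun a b c => if (a, b, c) is (0%N, 0%N, 0%N) then 1 else 0).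
Proof.
rewrite -mulrA; apply/fpsP => j; apply/fpsP => i; apply/fpsP => n.
rewrite fpsC_mulE fpsC_mulE fpsX_mulE fpsC_mulE fpsX_mulE /=.
case: n i j => [|n] [|i] [|[|j]] //=; try by [case: ifP => //; lia].
  by case: i n => [|i] [|n] //=; case: ifP => //; lia.
by case: ifP => // le_ij; case: i le_ij => // le_ij; rewrite subSS.
Qed.

(** The Fibonacci recurrence of [head_paths] in a; the terms without [A] come from
    a = 0 and a = 1.  The term on the left is kept there to avoid
    subtractions between counts. *)
Lemma all_seriesE :
  let u := var_x * var_s * var_t in
  let A := box_series (fun a b c => (all_paths a b c)%:R) in
  A + u * inner_series Deep = u * A + u * (u * A)
    + (inner_series Full + inner_series Deep
       + u * (inner_series Gap + inner_series Jump)).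
Proof.
rewrite /= /inner_series !box_seriesD !var_xst_box !box_seriesD.
apply: eq_box_series => a b c.
have allE a' : (all_paths a' b c)%:R = (head_paths a' Full)%:R * (inner_paths c b Full)%:R
    + (head_paths a' Gap)%:R * (inner_paths c b Gap)%:R
    + (head_paths a' Jump)%:R * (inner_paths c b Jump)%:R
    + (head_paths a' Deep)%:R * (inner_paths c b Deep)%:R :> rat.
  by rewrite /all_paths /shapes !big_cons big_nil -!natrM -!natrD addn0 !addnA.
case: a => [|[|[|a]]]; rewrite !allE.
- by rewrite /= mulr0n mulr1n; ring.
- by rewrite /= mulr0n mulr1n; ring.
- by rewrite /= mulr0n mulr1n; ring.
by rewrite /head_paths !fibSS !natrD; ring.
Qed.

Lemma inner_seriesE : let v := var_x * var_t in
 [/\ inner_series Full =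
      tail_series + v * (inner_series Full + inner_series Gap + inner_series Jump),
  inner_series Gap = var_x * tail_series + v * (inner_series Full + inner_series Deep),
  inner_series Jump + var_x * tail_series =
      tail_series + v * (inner_series Gap + inner_series Deep) &
  inner_series Deep = var_x * tail_series + v * inner_series Full].
Proof.
rewrite /= /inner_series /tail_series !box_seriesD !var_xt_box !var_x_box !box_seriesD.
split; apply: eq_box_series => -[|a] [|b] c; rewrite ?inner_pathsS.
all: try by rewrite /= ?natrD !addr0 ?add0r.
all: try by case: c => [|c] /=; rewrite ?natrD ?addr0 ?add0r.
by case: c => [|c]; rewrite addr0 //= -natrD addnC.
Qed.

Lemma tail_seriesE : tail_series = var_x * tail_series + var_x * (var_x * tail_series)
  + var_x * var_s * var_t.
Proof.
rewrite var_xstE /tail_series !var_x_box !box_seriesD.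
apply: eq_box_series => -[|a] [|b] [|[|c]] //=; rewrite ?addr0 ?add0r //.
by rewrite -natrD.
Qed.

(** * Elimination *)

(** Here E stands for [tail_series] and Y0, Y1, Y2, Y3 for the [inner_series] of [Full],
    [Gap], [Jump], [Deep].  Only Y0 satisfies a genuine recursion: substituting Y1, Y2 and Y3 leaves one
    equation for Y0, whose coefficient is the quartic in v. *)
Lemma eliminate_series (F : fieldType) (x s t A Y0 Y1 Y2 Y3 E : F) :
  let v := x * t in let u := x * s * t in
  t != 0 -> 1 - x - x ^+ 2 != 0 -> 1 - u - u ^+ 2 != 0 ->
  1 - v - v ^+ 2 - 3%:R * v ^+ 3 - v ^+ 4 != 0 ->
  E = x * E + x * (x * E) + u ->
  Y0 = E + v * (Y0 + Y1 + Y2) ->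
  Y1 = x * E + v * (Y0 + Y3) ->
  Y2 + x * E = E + v * (Y1 + Y3) ->
  Y3 = x * E + v * Y0 ->
  A + u * Y3 = u * A + u * (u * A) + (Y0 + Y3 + u * (Y1 + Y2)) ->
  A = 1 / (t * (1 - x - x ^+ 2)) *
    ((1 - x) * t * genH (x * t) s + genP (x * t) s
     - x * s * t / (1 - x * s * t - (x * s * t) ^+ 2)).
Proof.
move=> v u t0 x0 u0 v0 eE e0 e1 e2 e3 eA.
have Y1E : Y1 = (x + v * x) * E + (v + v ^+ 2) * Y0 by rewrite e1 e3; ring.
have Y2E : Y2 = (1 - x) * E + v * (Y1 + Y3).
  by rewrite mulrBl mul1r addrAC -e2 addrK.
have EE : E = u / (1 - x - x ^+ 2).
  apply: canRL (mulfK x0) _; apply/eqP; rewrite -subr_eq0; apply/eqP.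
  rewrite -[RHS](subrr E) {3}eE; ring.
have Y0E : Y0 = (1 + v + x * (3%:R * v ^+ 2 + v ^+ 3)) * E
    / (1 - v - v ^+ 2 - 3%:R * v ^+ 3 - v ^+ 4).
  apply: canRL (mulfK v0) _; apply/eqP; rewrite -subr_eq0; apply/eqP.
  rewrite -[RHS](subrr Y0) [in X in _ = _ - X]e0 Y2E e3 Y1E; ring.
have AE : A = (Y0 + (1 - u) * Y3 + u * (Y1 + Y2)) / (1 - u - u ^+ 2).
  apply: canRL (mulfK u0) _; apply/eqP; rewrite -subr_eq0; apply/eqP.
  rewrite -[RHS](subrr (A + u * Y3)) [in X in _ = _ - X]eA; ring.
have vE : v = x * t by [].
have vs : v * s = u by rewrite /v /u; ring.
rewrite AE Y2E e3 Y1E Y0E EE /genH /genP -/v -/u -vs; rewrite -vs in u0.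
move: v u vE x0 u0 v0 t0 vs {eE e0 e1 e2 e3 eA Y1E Y2E EE Y0E AE}
  => v u vE x0 u0 v0 t0 vs.
by rewrite vE; field; rewrite -vE u0 v0 x0 t0.
Qed.

Lemma alternation_seriesE (R : realType) :
  alternation_series R = box_series (fun a b c => (all_paths a b c)%:R).
Proof.
apply/fpsP => j; apply/fpsP => i; apply/fpsP => n /=.
case: ifP => // /andP[/andP[i_gt0 le_ij] le_jn]; congr (_%:R).
rewrite card_weyl_alternation ?i_gt0 //.
by apply: paths_all; lia.
Qed.

(** All denominators except t have this form. *)
Lemma one_sub_var_x_neq0 (f : fps3) : 1 - var_x * f != 0.
Proof.
rewrite subr_eq0; apply/eqP => /(congr1 (fun g : fps3 => g 0%N 0%N 0%N)).
by rewrite !fpsC_mulE fpsX_mulE /= => /eqP; rewrite oner_eq0.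
Qed.

Lemma one_sub_var_x_frac_neq0 (f : fps3) : 1 - var_x%:F * f%:F != 0 :> {fraction fps3}.
Proof.
by rewrite -tofrac1 -tofracM -tofracB
  tofrac_eq0 one_sub_var_x_neq0.
Qed.

Lemma var_t_neq0 : var_t != 0.
Proof.
apply/eqP => /(congr1 (fun g : fps3 => g 1%N 0%N 0%N)) /eqP.
by rewrite /= oner_eq0.
Qed.

Theorem theorem5p14 (R : realType) :
  let x : {fraction fps3} := var_x%:F in
  let s : {fraction fps3} := var_s%:F in
  let t : {fraction fps3} := var_t%:F in
  (alternation_series R)%:F =
    1 / (t * (1 - x - x ^+ 2)) *
    ((1 - x) * t * genH (x * t) s + genP (x * t) s
     - x * s * t / (1 - x * s * t - (x * s * t) ^+ 2)).
Proof.
have [e0 e1 e2 e3] := inner_seriesE; have eE := tail_seriesE; have eA := all_seriesE.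
rewrite /= in e0 e1 e2 e3 eE eA; rewrite /= alternation_seriesE.
have tofracF (a b : fps3) : a = b -> a%:F = b%:F by move=> ->.
have frac := (tofracM, tofracD).
move/tofracF: e0; move/tofracF: e1; move/tofracF: e2; move/tofracF: e3.
move/tofracF: eE; move/tofracF: eA; rewrite !frac => eA eE e3 e2 e1 e0.
have nz (d : {fraction fps3}) (f : fps3) : d = 1 - var_x%:F * f%:F -> d != 0.
  by move=> ->; exact: one_sub_var_x_frac_neq0.
apply: (eliminate_series _ _ _ _ _ _ _ _ _ _ _ _ _ _ eE e0 e1 e2 e3 eA).
- by rewrite tofrac_eq0 var_t_neq0.
- apply: (nz _ (1 + var_x)); rewrite tofracD tofrac1; ring.
- apply: (nz _ (var_s * var_t + var_x * (var_s * var_t) ^+ 2)).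
  rewrite tofracD !tofracM; ring.
apply: (nz _ (var_t + var_x * var_t ^+ 2 + var_x ^+ 2 * var_t ^+ 3 *+ 3
  + var_x ^+ 3 * var_t ^+ 4)).
rewrite !(tofracD, tofracM, tofracXn, tofracMn); ring.
Qed.
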